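(* Let $p$ be a prime number such that $p \equiv 1 \pmod 4$. Then: (i) if $p = 5$ or $p \equiv 1 \pmod 3$, then $l\left(\frac{1+3\sqrt{p}}{2}\right) \equiv 2 \pmod 4$; (ii) if $p \equiv 2 \pmod 3$ and $p \neq 5$, then $l\left(\frac{1+3\sqrt{p}}{2}\right) \equiv 0 \pmod 4$.
   Context: For a real quadratic irrational number $\alpha$, $l(\alpha)$ denotes the minimal period length of its (eventually periodic) usual (regular) continued fraction expansion $a_0+\cfrac{1}{a_1+\cfrac{1}{a_2+\cdots}}$ with $a_0\in\mathbb{Z}$ and $a_i$ positive integers for $i\ge 1$. *)

(* Defs.v *)
From mathcomp Require Import all_boot all_order all_algebra.
From mathcomp Require Import all_classical all_reals all_analysis.
Export numFieldNormedType.Exports.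

Set Implicit Arguments.
Unset Strict Implicit.
Unset Printing Implicit Defensive.

Import Order.TTheory GRing.Theory Num.Theory.

Local Open Scope classical_set_scope.
Local Open Scope ring_scope.

(* a_0 + 1/(a_1 + 1/(... + 1/a_n)) *)
Fixpoint cf_convergent (R : realType) (a : nat -> int) (n : nat) : R :=
  if n is m.+1 then (a 0)%:~R + (cf_convergent R (fun i => a i.+1) m)^-1
  else (a 0)%:~R.

(* Only infinite expansions are considered, so x is necessarily irrational, and
   a is then determined by x. *)
Definition regular_cf_expansion (R : realType) (x : R) (a : nat -> int) : Prop :=
  (forall i : nat, (0 < i)%N -> 0 < a i) /\
  cf_convergent R a n @[n --> \oo] --> x.

Definition eventual_period (a : nat -> int) (l : nat) : Prop :=
  (0 < l)%N /\ exists N : nat, forall i : nat, (N <= i)%N -> a (i + l)%N = a i.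

(* l is l(x): in particular, this entails that the expansion of x is eventually
   periodic. *)
Definition is_cf_period_length (R : realType) (x : R) (l : nat) : Prop :=
  exists a : nat -> int,
    [/\ regular_cf_expansion x a,
        eventual_period a l &
        forall m : nat, eventual_period a m -> (l <= m)%N].

(* Main.v *)
(* Write [alpha], up to an integer, as the root of the reduced principal form of
   discriminant [9 p]. One step of the expansion permutes the finitely many
   reduced forms of this discriminant and negates the represented values, so the
   [j]-th form of the principal cycle represents [(-1)^j]; the period [l] is the
   length of that cycle. Reversing the cycle ([x] goes to [-1 / x'], with [x'] the
   conjugate of [x]) is a symmetry of it, whose second fixed point lies half-way.
   For [l] odd it would be a form [(a, b, -a)] with [b^2 + 4 a^2 = 9 p], which is
   divisible by 3. For [l = 2 k] it is an ambiguous form [(a, a n, -c)] with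
   [a | 9 p] and [a <> 1]; since it is reduced and represents [(-1)^k], either
   [a = 9], or [a = p = 5]. In the first case [4 (-1)^k = w^2 - p v^2] with
   [3 | w], so that [p mod 3] decides the sign; the second is a congruence
   mod 3 as well. *)
Require Import Defs.
From mathcomp Require Import all_boot all_order all_algebra.
From mathcomp Require Import all_classical all_reals all_analysis.
From mathcomp Require Import zify ring lra.

Set Implicit Arguments.
Unset Strict Implicit.
Unset Printing Implicit Defensive.

Import Order.TTheory GRing.Theory Num.Theory.

Local Open Scope ring_scope.

(** * Reduced indefinite binary quadratic forms *)

(* [QForm a b c] stands for the form [a u^2 - b u v - c v^2], whose positive root
   [u / v] is [(b + sqrt (b^2 + 4 a c)) / (2 a)]. *)
Record qform := QForm { qa : int; qb : int; qc : int }.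

Definition qval (q : qform) (u v : int) : int :=
  qa q * u * u - qb q * u * v - qc q * v * v.

Definition qdisc (q : qform) : int := qb q * qb q + 4 * qa q * qc q.

(* The inequalities say that the form is negative at [0] and [1] and positive at
   [-1], i.e. that its roots [x], [x'] satisfy [x > 1] and [-1 < x' < 0]. *)
Definition qreduced (D : int) (q : qform) : Prop :=
  [/\ 0 < qa q, 0 < qc q, qa q - qc q < qb q, qc q - qa q < qb q & qdisc q = D].

Definition nonsquare (D : int) : Prop := forall z : int, z * z <> D.

(** The integer part of the positive root, pinned down by signs alone; strict signs suffice because
    the root is irrational for a nonsquare discriminant. *)
Definition is_quot (q : qform) (n : int) : Prop :=
  [/\ 0 <= n, qval q n 1 < 0 & 0 < qval q (n + 1) 1].

Definition quot (q : qform) : int := xget 0 [set n | is_quot q n]%classic.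

(* If [x] is the root of [q], then [qstep q] has root [1 / (x - quot q)]. *)
Definition qstep (q : qform) : qform :=
  QForm (- qval q (quot q) 1) (2 * qa q * quot q - qb q) (qa q).

(* Exchanges the root [x] with [-1 / x'], where [x'] is its conjugate. *)
Definition qflip (q : qform) : qform := QForm (qc q) (qb q) (qa q).

Lemma qval_neq0 D q n : nonsquare D -> qreduced D q -> qval q n 1 <> 0.
Proof.
move=> nsq [a0 c0 h1 h2 hD] h0; apply: (nsq (2 * qa q * n - qb q)).
by rewrite -hD; move: h0; rewrite /qval /qdisc => h0; nia.
Qed.

(** Dividing the value at [t] by [t] gives [a t - b - c / t], which increases for [t > 0]; [E] is
    this fact without denominators. *)
Lemma qval_root_monotone q (k m : int) : 0 < qa q -> 0 < qc q ->
  0 < k -> k <= m -> 0 < qval q k 1 -> 0 < qval q m 1.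
Proof.
move=> a0 c0 k0 km hk.
have E : k * qval q m 1 = m * qval q k 1 + (m - k) * (qa q * k * m + qc q).
  by rewrite /qval; ring.
have m0 : 0 < m by lia.
have h1 : 0 < m * qval q k 1 by rewrite mulr_gt0.
have h2 : 0 <= (m - k) * (qa q * k * m + qc q).
  by rewrite mulr_ge0 ?subr_ge0 // addr_ge0 ?ltW // !mulr_gt0.
by rewrite -(pmulr_rgt0 _ k0) E; lia.
Qed.

Lemma is_quot_inj q n m : 0 < qa q -> 0 < qc q ->
  is_quot q n -> is_quot q m -> n = m.
Proof.
move=> a0 c0 [n0 n1 n2] [m0 m1 m2].
case: (ltgtP n m) => // [nm|mn].
- have : 0 < qval q m 1 by apply: (qval_root_monotone (k := n + 1)) => //; lia.
  lia.
- have : 0 < qval q n 1 by apply: (qval_root_monotone (k := m + 1)) => //; lia.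
  lia.
Qed.

Lemma quot_eq D q n : qreduced D q -> is_quot q n -> quot q = n.
Proof.
move=> [a0 c0 _ _ _] hn; apply: (is_quot_inj a0 c0) => //.
exact: (xgetPex 0 (ex_intro _ n hn : exists m, [set m | is_quot q m]%classic m)).
Qed.

Lemma quotP D q : nonsquare D -> qreduced D q -> is_quot q (quot q).
Proof.
move=> nsq hq; have [a0 c0 h1 h2 hD] := hq.
have ex : exists m : nat, 0 < qval q (m.+1)%:Z 1.
  exists (absz (qb q + qc q)).
  have -> : (absz (qb q + qc q)).+1%:Z = qb q + qc q + 1 by lia.
  have -> : qval q (qb q + qc q + 1) 1 = (qb q + qc q) * (qc q + 1) + 1 +
      (qa q - 1) * ((qb q + qc q + 1) * (qb q + qc q + 1)).
    by rewrite /qval; ring.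
  by rewrite ltr_wpDr ?ltr_wpDl ?mulr_ge0 //; lia.
apply: (xgetPex 0 (_ : exists m, [set m | is_quot q m]%classic m)).
case: (ex_minnP ex) => m hm mmin; exists m%:Z; split; first by [].
- case: m hm mmin => [|m] hm mmin; first by rewrite /qval; lia.
  have := qval_neq0 (n := m.+1%:Z) nsq hq.
  have : ~ (0 < qval q m.+1%:Z 1) by move=> /mmin; lia.
  lia.
- by have -> : m%:Z + 1 = m.+1%:Z by lia.
Qed.

Lemma quot_gt0 D q : nonsquare D -> qreduced D q -> 0 < quot q.
Proof.
move=> nsq hq; have [n0 _ n2] := quotP nsq hq; have [a0 c0 h1 _ _] := hq.
case: (ltgtP 0 (quot q)) n0 n2 => // <- _; rewrite /qval; lia.
Qed.

Lemma qdisc_step q : qdisc (qstep q) = qdisc q.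
Proof. by rewrite /qdisc /qstep /= /qval; ring. Qed.

Lemma qreduced_step D q : nonsquare D -> qreduced D q -> qreduced D (qstep q).
Proof.
move=> nsq hq; have [n0 n1 n2] := quotP nsq hq; have n_gt0 := quot_gt0 nsq hq.
have [a0 c0 h1 h2 hD] := hq; split; rewrite ?qdisc_step //=.
all: move: n0 n1 n2 n_gt0; rewrite /qval; set n := quot q => n0 n1 n2 n_gt0.
- lia.
- lia.
(* The remaining inequality is negativity at [n - 1]. The identity is that of [qval_root_monotone],
   and here it also covers [n = 1]. *)
- have E : n * (qa q * (n - 1) * (n - 1) - qb q * (n - 1) - qc q) =
    (n - 1) * (qa q * n * n - qb q * n * 1 - qc q * 1 * 1) -
    qa q * n * (n - 1) - qc q by ring.
  have : qa q * (n - 1) * (n - 1) - qb q * (n - 1) - qc q < 0.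
    rewrite -(pmulr_rlt0 _ n_gt0) E.
    have : (n - 1) * (qa q * n * n - qb q * n * 1 - qc q * 1 * 1) <= 0.
      by rewrite mulr_ge0_le0 //; lia.
    have : 0 <= qa q * n * (n - 1) by rewrite !mulr_ge0 //; lia.
    lia.
  lia.
Qed.

Lemma qreduced_iter D q i : nonsquare D -> qreduced D q ->
  qreduced D (iter i qstep q).
Proof. by move=> nsq hq; elim: i => //= i; exact: qreduced_step. Qed.

Lemma qreduced_flip D q : qreduced D q -> qreduced D (qflip q).
Proof. by case=> a0 c0 h1 h2 hD; split=> //; rewrite -hD /qdisc /=; ring. Qed.

Lemma qflipK : involutive qflip.
Proof. by case. Qed.

(** If [y = 1 / (x - n)], then [-1 / y' = n - x'] has integer part [n] since [-1 < x' < 0], and the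
    next step leads to [-1 / x']. So [qflip] turns [qstep] into its inverse. *)
Lemma qstep_flip_step D q : nonsquare D -> qreduced D q ->
  qstep (qflip (qstep q)) = qflip q.
Proof.
move=> nsq hq; have [n0 n1 n2] := quotP nsq hq; have [a0 c0 h1 h2 hD] := hq.
have En : quot (qflip (qstep q)) = quot q.
  apply: (quot_eq (D := D)).
    exact/qreduced_flip/qreduced_step.
  split=> //; move: n1 n2; rewrite /qval /qflip /qstep /= /qval; lia.
rewrite {1}/qstep En /qflip /qstep /qval /=; congr QForm; ring.
Qed.

Lemma iter_qstep_flip D q i : nonsquare D -> qreduced D q ->
  iter i qstep (qflip (iter i qstep q)) = qflip q.
Proof.
move=> nsq hq; elim: i => // i IHi.
by rewrite iterSr iterS (qstep_flip_step nsq) //; exact: qreduced_iter.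
Qed.

Lemma iter_qstep_inj D q r i : nonsquare D -> qreduced D q -> qreduced D r ->
  iter i qstep q = iter i qstep r -> q = r.
Proof.
move=> nsq hq hr E; apply: (can_inj qflipK).
by rewrite -(iter_qstep_flip i nsq hq) E (iter_qstep_flip i nsq hr).
Qed.

Definition represents (q : qform) (e : int) : Prop :=
  exists u v : int, qval q u v = e.

(** [qstep q] is [- q] in the coordinates [(v, u - quot q * v)]. *)
Lemma represents_step q e : represents q e -> represents (qstep q) (- e).
Proof.
case=> u [v <-]; exists v, (u - quot q * v).
by rewrite /qstep /qval /=; ring.
Qed.

Lemma represents_iter q i : represents q 1 ->
  represents (iter i qstep q) ((-1) ^+ i).
Proof.
move=> h; elim: i => //= i /represents_step; by rewrite exprS mulN1r.
Qed.

Lemma qreduced_le D q : qreduced D q ->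
  [/\ qa q <= D, 0 < qb q <= D & qc q <= D].
Proof.
case=> a0 c0 h1 h2 <-; have b0 : 0 < qb q by lia.
rewrite /qdisc; have h3 : 0 < qb q * qb q by rewrite mulr_gt0.
have h4 : qa q <= qa q * qc q by rewrite ler_peMr; lia.
have h5 : qc q <= qa q * qc q by rewrite ler_peMl; lia.
have h6 : qb q <= qb q * qb q by rewrite ler_peMl; lia.
split; lia.
Qed.

(** Bounded coefficients force two iterates to coincide; injectivity of [qstep] then removes the
    preperiod. *)
Lemma qstep_periodic D q : nonsquare D -> qreduced D q ->
  exists l : nat, (0 < l)%N /\ iter l qstep q = q.
Proof.
move=> nsq hq; pose M := (absz D).+1.
pose code (i : 'I_(M * M * M).+1) : 'I_M * 'I_M * 'I_M :=
  let r := iter i qstep q in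
  (inord (absz (qa r)), inord (absz (qb r)), inord (absz (qc r))).
have /injectivePn[i [j nij Eij]] : ~~ injectiveb code.
  apply/negP => /injectiveP /leq_card.
  by rewrite !card_prod !card_ord ltnn.
wlog ltij : i j nij Eij / (i < j)%N.
  move=> H; case: (ltngtP i j) => [|h|/val_inj E]; first exact: H.
    by apply: (H j i) => //; rewrite eq_sym.
  by rewrite E eqxx in nij.
exists (j - i)%N; split; first by rewrite subn_gt0.
apply: (iter_qstep_inj (i := i) nsq _ hq); first exact: qreduced_iter.
rewrite -iterD subnKC 1?ltnW //.
have [hi1 /andP[hi2 hi3] hi4] := qreduced_le (qreduced_iter i nsq hq).
have [hj1 /andP[hj2 hj3] hj4] := qreduced_le (qreduced_iter j nsq hq).
have [ai ci _ _ _] := qreduced_iter i nsq hq.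
have [aj cj _ _ _] := qreduced_iter j nsq hq.
have bnd (x : int) : 0 < x -> x <= D -> (absz x < M)%N by rewrite /M; lia.
have absz_inj (x y : int) : 0 < x -> 0 < y -> absz x = absz y -> x = y by lia.
move: Eij; rewrite /code.
case=> /(congr1 val) /= + /(congr1 val) /= + /(congr1 val) /=.
rewrite !inordK ?bnd // => /absz_inj Ea /absz_inj Eb /absz_inj Ec.
move: (Ea ai aj) (Eb hi2 hj2) (Ec ci cj) => {Ea Eb Ec}.
by case: (iter i _ _) (iter j _ _) => [a b c] [a' b' c'] /= -> -> ->.
Qed.

(** * Continued fractions *)

Lemma cf_convergent_ge1 (R : realType) (a : nat -> int) n :
  (forall i, 0 < a i) -> 1 <= cf_convergent R a n.
Proof.
elim: n a => [|n IHn] a a0 /=; first by rewrite ler1z -gtz0_ge1.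
have h1 : 1 <= (a 0%N)%:~R :> R by rewrite ler1z -gtz0_ge1.
have h2 := IHn (fun i => a i.+1) (fun i => a0 i.+1).
by rewrite (le_trans h1) // lerDl invr_ge0 (le_trans ler01).
Qed.

(* Two steps of the expansion contract by a factor of 4, since
   [1 / (k + 1 / y) - 1 / (k + 1 / c) = (y - c) / ((k y + 1) (k c + 1))]. *)
Lemma cf_convergent_dist (R : realType) (a : nat -> int) (x : nat -> R) n :
  (forall i, 0 < a i.+1) -> (forall i, x i = (a i)%:~R + (x i.+1)^-1) ->
  (forall i, 1 < x i.+1) ->
  `|x 0%N - cf_convergent R a n| <= 2 * 2^-1 ^+ n.
Proof.
have [m] := ubnP n; elim: m => // m IHm in n a x *.
rewrite ltnS => nm a0 xE x1; case: n nm => [|[|n]] nm /=.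
- have := x1 0%N; rewrite (xE 0%N) addrAC subrr add0r expr0 mulr1 => h.
  have i0 : 0 < (x 1%N)^-1 by rewrite invr_gt0 (lt_trans ltr01).
  have i1 : (x 1%N)^-1 < 1 by rewrite invf_lt1 // (lt_trans ltr01).
  by rewrite ler_norml; apply/andP; split; lra.
- have h1 := x1 0%N; have k1 : 1 <= (a 1%N)%:~R :> R by rewrite ler1z -gtz0_ge1.
  rewrite (xE 0%N) opprD addrACA subrr add0r expr1 divff ?pnatr_eq0 //.
  have i0 : 0 < (x 1%N)^-1 by rewrite invr_gt0 (lt_trans ltr01).
  have i1 : (x 1%N)^-1 < 1 by rewrite invf_lt1 // (lt_trans ltr01).
  have j0 : 0 < ((a 1%N)%:~R)^-1 :> R by rewrite invr_gt0 (lt_le_trans ltr01).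
  have j1 : ((a 1%N)%:~R)^-1 <= 1 :> R by rewrite invf_le1 // (lt_le_trans ltr01).
  by rewrite ler_norml; apply/andP; split; lra.
- have := IHm n (fun i => a i.+2) (fun i => x i.+2).
  move=> /(_ (ltnW nm) (fun i => a0 _) (fun i => xE _) (fun i => x1 _)).
  have := cf_convergent_ge1 R n (fun i => a0 i.+1).
  have := x1 1%N; rewrite (xE 0%N) (xE 1%N).
  have : 1 <= (a 1%N)%:~R :> R by rewrite ler1z -gtz0_ge1.
  rewrite (_ : (fun i => a i.+2) = (fun i => (fun j => a j.+1) i.+1)) //.
  move: (cf_convergent _ _ n) (x 2%N) ((a 1%N)%:~R) ((a 0%N)%:~R).
  move=> c y k k0 hk hy hc hyc.
  have E : k0 + (k + y^-1)^-1 - (k0 + (k + c^-1)^-1) =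
      (y - c) / ((k * y + 1) * (k * c + 1)).
    by field; rewrite !gt_eqF //; nra.
  have h2 : 2 <= k * y + 1 by nra.
  have h3 : 2 <= k * c + 1 by nra.
  rewrite E normrM normfV (ger0_norm (x := _ * _)); last by nra.
  rewrite ler_pdivrMr; last by nra.
  apply: (le_trans hyc); rewrite !exprS.
  have : 0 <= 2^-1 ^+ n :> R by rewrite exprn_ge0 // invr_ge0.
  move: (2^-1 ^+ n) => t t0.
  have : 4 <= (k * y + 1) * (k * c + 1) by nra.
  move: (_ * (k * c + 1)) => s hs.
  have -> : 2 * (2^-1 * (2^-1 * t)) = t / 2 by field.
  nra.
Qed.

Lemma cf_convergent_cvg (R : realType) (a : nat -> int) (x : nat -> R) :
  (forall i, 0 < a i.+1) -> (forall i, x i = (a i)%:~R + (x i.+1)^-1) ->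
  (forall i, 1 < x i.+1) ->
  (cf_convergent R a n @[n --> \oo] --> x 0%N)%classic.
Proof.
move=> a0 xE x1.
have h : (2 * 2^-1 ^+ n @[n --> \oo] --> (0 : R))%classic.
  rewrite -[X in (_ --> X)%classic](mulr0 2); apply: cvgMl_tmp.
  by apply: cvg_expr; rewrite ger0_norm ?invr_ge0 // invf_lt1 ?ltr1n.
apply: (@squeeze_cvgr _ _ _ _ (fun n => x 0%N - 2 * 2^-1 ^+ n)
                              (fun n => x 0%N + 2 * 2^-1 ^+ n)).
- apply: nearW => n; have := cf_convergent_dist n a0 xE x1.
  by rewrite ler_norml => /andP[h1 h2]; apply/andP; split; lra.
- rewrite -[X in (_ --> X)%classic](subr0 (x 0%N)).
  by apply: cvgB => //; exact: cvg_cst.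
- rewrite -[X in (_ --> X)%classic](addr0 (x 0%N)).
  by apply: cvgD => //; exact: cvg_cst.
Qed.

Lemma complete_quotient_unique (R : realType) (a : nat -> int) (x y : nat -> R) :
  (forall i, 0 < a i.+1) ->
  (forall i, x i = (a i)%:~R + (x i.+1)^-1) -> (forall i, 1 < x i.+1) ->
  (forall i, y i = (a i)%:~R + (y i.+1)^-1) -> (forall i, 1 < y i.+1) ->
  x 0%N = y 0%N.
Proof.
move=> a0 xE x1 yE y1.
have hx := cf_convergent_cvg a0 xE x1; have hy := cf_convergent_cvg a0 yE y1.
by rewrite -(cvg_lim _ hx) // -(cvg_lim _ hy).
Qed.

(** * Roots of reduced forms as complete quotients *)

Definition qroot (R : realType) (D : int) (q : qform) : R :=
  ((qb q)%:~R + Num.sqrt D%:~R) / (2 * (qa q)%:~R).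

Lemma sqrt_qdisc (R : realType) D q : qreduced D q ->
  Num.sqrt D%:~R * Num.sqrt D%:~R =
  (qb q)%:~R * (qb q)%:~R + 4 * (qa q)%:~R * (qc q)%:~R :> R.
Proof.
move=> hq; have [a0 c0 h1 h2 hD] := hq; rewrite -expr2 sqr_sqrtr.
  by rewrite -hD /qdisc rmorphD !rmorphM.
by rewrite ler0z; have [h3 _ _] := qreduced_le hq; lia.
Qed.

Lemma qroot_gt1 (R : realType) D q : qreduced D q -> 1 < qroot R D q.
Proof.
have main (a b c w : R) : 0 <= w -> 0 < a -> a - c < b ->
    w * w = b * b + 4 * a * c -> 2 * a < b + w.
  move=> w0 ha h E; rewrite ltNge; apply/negP => h'.
  have h3 : 0 < a * (b + c - a) by rewrite mulr_gt0 //; lra.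
  have h4 : w * w <= (2 * a - b) * (2 * a - b) by apply: ler_pM => //; lra.
  nra.
move=> hq; have [a0 c0 h1 h2 _] := hq.
rewrite /qroot ltr_pdivlMr ?mulr_gt0 ?ltr0z // mul1r.
apply: main (sqrt_qdisc R hq); rewrite ?sqrtr_ge0 ?ltr0z //.
by rewrite -rmorphB ltr_int.
Qed.

Lemma qroot_step (R : realType) D q : nonsquare D -> qreduced D q ->
  qroot R D q = (quot q)%:~R + (qroot R D (qstep q))^-1.
Proof.
move=> nsq hq; have [s1 _ s2 s3 _] := qreduced_step nsq hq.
have b0 : 0 < qb (qstep q) by lia.
have [a0 _ _ _ _] := hq.
have main (a b c w n : R) : 0 <= w -> 0 < a -> w * w = b * b + 4 * a * c ->
    0 < 2 * a * n - b -> 0 < - (a * n * n - b * n * 1 - c * 1 * 1) ->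
    (b + w) / (2 * a) = n +
      ((2 * a * n - b + w) / (2 * - (a * n * n - b * n * 1 - c * 1 * 1)))^-1.
  move=> w0 ha E hb ha'; have a_neq0 : 2 * a != 0 by rewrite gt_eqF // mulr_gt0.
  have x_neq0 : 2 * a * n - b + w != 0 by rewrite gt_eqF // ltr_wpDr.
  have -> : (b + w) / (2 * a) = n + (b + w - 2 * a * n) / (2 * a).
    by field; rewrite gt_eqF.
  rewrite invf_div; congr (_ + _); apply/eqP; rewrite eqr_div //; apply/eqP.
  (* Both sides equal [-4 a] times the value of the form at [n]. *)
  transitivity (w * w - (2 * a * n - b) * (2 * a * n - b)); first by ring.
  by rewrite E; ring.
have := main (qa q)%:~R (qb q)%:~R (qc q)%:~R (Num.sqrt D%:~R) (quot q)%:~R.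
move=> /(_ (sqrtr_ge0 _)); rewrite ltr0z => /(_ a0 (sqrt_qdisc R hq)).
move: b0 s1; rewrite -!(ltr0z R) /qroot /qstep /= /qval.
rewrite !(rmorphM, rmorphB, rmorphN, rmorph1) /= => b0 s1; exact.
Qed.

Lemma nonsquare_scale D (d z : int) : nonsquare D -> D * d * d = z * z -> d = 0.
Proof.
move=> nsq E; apply/eqP/negPn/negP => d0.
have : (d ^+ 2 %| z ^+ 2)%Z by apply/dvdzP; exists D; rewrite !expr2 -E mulrA.
rewrite dvdz_pexp2r // => /dvdzP[e ez].
apply: (nsq e); apply: (mulIf d0); apply: (mulIf d0); rewrite E ez; ring.
Qed.

(** Clearing denominators makes [sqrt D] times an integer equal to an integer; irrationality makes
    both vanish, and the discriminant then fixes the last coefficient. *)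
Lemma qroot_inj (R : realType) D q r : nonsquare D ->
  qreduced D q -> qreduced D r -> qroot R D q = qroot R D r -> q = r.
Proof.
move=> nsq hq hr; have [a0 c0 _ _ hD] := hq; have [a0' c0' _ _ hD'] := hr.
have w2 : Num.sqrt D%:~R * Num.sqrt D%:~R = D%:~R :> R.
  by rewrite (sqrt_qdisc R hq) -hD /qdisc rmorphD !rmorphM.
have main (w : R) : w * w = D%:~R ->
    ((qb q)%:~R + w) / (2 * (qa q)%:~R) = ((qb r)%:~R + w) / (2 * (qa r)%:~R) ->
    qa q = qa r /\ qb q = qb r.
  have aR : 2 * (qa q)%:~R != 0 :> R.
    by rewrite mulf_neq0 ?pnatr_eq0 ?intr_eq0 ?gt_eqF.
  have aR' : 2 * (qa r)%:~R != 0 :> R.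
    by rewrite mulf_neq0 ?pnatr_eq0 ?intr_eq0 ?gt_eqF.
  move=> hw /eqP; rewrite eqr_div // => /eqP E.
  have E2 : w * (qa r - qa q)%:~R = (qb r * qa q - qb q * qa r)%:~R.
    rewrite !(rmorphB, rmorphM) /=.
    apply: (mulfI (_ : 2 != 0 :> R)); first by rewrite pnatr_eq0.
    have e (a b c d : R) : 2 * (w * (c - a)) - 2 * (d * a - b * c) =
        (b + w) * (2 * c) - (d + w) * (2 * a) by ring.
    by apply/eqP; rewrite -subr_eq0 e E subrr.
  have Ea : qa r - qa q = 0.
    apply: (nonsquare_scale nsq (z := qb r * qa q - qb q * qa r)).
    by apply: (@intr_inj R); rewrite [RHS]intrM -E2 !intrM -hw; ring.
  have {}Ea : qa r = qa q by lia.
  split=> //; move: E2; rewrite Ea subrr mulr0 => /eqP; rewrite eq_sym intr_eq0.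
  by rewrite -mulrBl mulf_eq0 subr_eq0 (gt_eqF a0) orbF => /eqP.
move=> /(main _ w2)[]; move: hD; rewrite -hD' /qdisc.
case: q r a0 {hq hr hD' c0 c0' a0' main} => [a b c] [a' b' c'] /= a0 + Ea Eb.
rewrite -Ea -Eb => /addrI E; congr QForm; apply: (mulfI (_ : 4 * a != 0)) => //.
by lia.
Qed.

Lemma quot_seq_complete (R : realType) D q : nonsquare D -> qreduced D q ->
  [/\ forall i, 0 < quot (iter i qstep q),
      forall i, qroot R D (iter i qstep q) =
        (quot (iter i qstep q))%:~R + (qroot R D (iter i.+1 qstep q))^-1 &
      forall i, 1 < qroot R D (iter i qstep q)].
Proof.
move=> nsq hq; split=> i.
- exact: quot_gt0 nsq (qreduced_iter i nsq hq).
- exact: qroot_step nsq (qreduced_iter i nsq hq).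
- exact: qroot_gt1 (qreduced_iter i nsq hq).
Qed.

(** Quotients determine the root, hence the form: this turns periods of the expansion into periods
    of the cycle of forms. *)
Lemma quot_seq_inj (R : realType) D q r : nonsquare D ->
  qreduced D q -> qreduced D r ->
  (forall i, quot (iter i qstep q) = quot (iter i qstep r)) -> q = r.
Proof.
move=> nsq hq hr E; apply: (qroot_inj (R := R) nsq hq hr).
have [q0 qE q1] := quot_seq_complete R nsq hq.
have [r0 rE r1] := quot_seq_complete R nsq hr.
apply: (complete_quotient_unique (a := fun i => quot (iter i qstep q))
  (x := fun i => qroot R D (iter i qstep q))
  (y := fun i => qroot R D (iter i qstep r))) => i //.
by rewrite rE E.
Qed.

Lemma cf_period_length_qroot (R : realType) D q (m : int) l :
  nonsquare D -> qreduced D q -> (0 < l)%N -> iter l qstep q = q ->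
  (forall j, (0 < j)%N -> iter j qstep q = q -> (l <= j)%N) ->
  is_cf_period_length (qroot R D q + m%:~R) l.
Proof.
move=> nsq hq l0 hl lmin.
have [q0 qE q1] := quot_seq_complete R nsq hq.
exists (fun i => if i is 0%N then quot q + m else quot (iter i qstep q)); split.
- split; first by case.
  apply: (cf_convergent_cvg (x := fun i =>
    if i is 0%N then qroot R D q + m%:~R else qroot R D (iter i qstep q))) => // -[|i] //.
  by rewrite (qE 0%N) rmorphD /= addrAC.
- split=> //; exists 1%N => -[|i] // _; congr quot.
  by rewrite -[RHS](congr1 (iter i.+1 qstep) hl) -iterD.
- move=> t [t0 [N hN]]; apply: lmin => //.
  (* Starting at [N.+1] avoids index 0, where the expansion is shifted by [m]. *)
  apply: (iter_qstep_inj (i := N.+1) nsq _ hq); first exact: qreduced_iter.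
  rewrite -iterD; apply: (quot_seq_inj R nsq); try exact: qreduced_iter.
  move=> i; have := hN (i + N).+1; rewrite -!iterD addnA !addnS addSn.
  by apply; rewrite leqW // leq_addl.
Qed.

(** * The principal cycle *)

(** The maximal [m] with [m (m + 1) < k] makes [2 m + 1] the largest odd number below the square
    root of [4 k + 1]; nonsquareness rules out [k = (m + 1) (m + 2)]. *)
Lemma principal_qform (k : nat) : nonsquare (4 * k + 1)%N -> (0 < k)%N ->
  exists m : nat, qreduced (4 * k + 1)%N
    (QForm 1 (2 * m%:Z + 1) (k%:Z - m%:Z * m%:Z - m%:Z)).
Proof.
move=> nsq k0.
have ex : exists m : nat, (m * (m + 1) < k)%N by exists 0%N; rewrite mul0n.
have bnd (m : nat) : (m * (m + 1) < k)%N -> (m <= k)%N by nia.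
case: (ex_maxnP ex bnd) => m hm mmax; exists m.
have h1 : (k <= (m + 1) * (m + 2))%N.
  rewrite leqNgt; apply/negP => h.
  have /mmax : (m.+1 * (m.+1 + 1) < k)%N by move: h; rewrite !addn1 addn2.
  by rewrite ltnn.
have h2 : k <> ((m + 1) * (m + 2))%N.
  by move=> h; apply: (nsq (2 * m%:Z + 3)); rewrite h; lia.
by split; rewrite /qdisc /=; lia.
Qed.

(** The discriminant fixes the parity of [b], and reducedness makes [b] the largest number of that
    parity with square below [D]. *)
Lemma principal_qform_unique D q r : qreduced D q -> qreduced D r ->
  qa q = 1 -> qa r = 1 -> q = r.
Proof.
suff main (b c b' c' : int) : qreduced D (QForm 1 b c) ->
    qreduced D (QForm 1 b' c') -> b <= b'.
  case: q r => [a b c] [a' b' c'] hq hr /= Ea Ea'; rewrite {}Ea {}Ea' in hq hr *.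
  have E : b = b'.
    by apply/eqP; rewrite eq_le (main _ _ _ _ hq hr) (main _ _ _ _ hr hq).
  case: hq hr => _ _ _ _ + [_ _ _ _]; rewrite E /qdisc /= => <- ?.
  by congr QForm; lia.
case=> _ /= c0 h1 h2 hD [_ /= c0' h1' h2' hD'].
rewrite leNgt; apply/negP => lt; move: hD; rewrite -hD' /qdisc /= => E.
have h3 : b' + 2 <= b.
  have : b <> b' + 1 by move=> Eb; move: E; rewrite Eb; lia.
  lia.
have : (b' + 2) * (b' + 2) <= b * b by apply: ler_pM => //; lia.
lia.
Qed.

(** Here [x + x' = b] is the integer part of [x], so [1 / (x - b) = -1 / x']. *)
Lemma qstep_principal D q : nonsquare D -> qreduced D q -> qa q = 1 ->
  qstep q = qflip q.
Proof.
move=> nsq hq a1; have [a0 c0 h1 h2 hD] := hq.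
have En : quot q = qb q.
  by apply: (quot_eq hq); split; rewrite /qval ?a1; lia.
by rewrite /qstep /qflip En /qval a1; congr QForm; lia.
Qed.

Lemma represents_principal q : qa q = 1 -> represents q 1.
Proof. by move=> a1; exists 1, 0; rewrite /qval a1; lia. Qed.

(** On the principal cycle [qflip] sends index [i] to [1 - i]. Modulo [2 k + 1] this fixes [k + 1];
    modulo [2 k] it sends [k] to [k + 1]. *)
Lemma odd_period_middle D q k : nonsquare D -> qreduced D q -> qa q = 1 ->
  iter (2 * k + 1) qstep q = q ->
  qflip (iter k.+1 qstep q) = iter k.+1 qstep q.
Proof.
move=> nsq hq a1 hk; apply: (iter_qstep_inj (i := k.+1) nsq).
- exact/qreduced_flip/qreduced_iter.
- exact: qreduced_iter.
rewrite (iter_qstep_flip _ nsq hq) -iterD.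
have -> : (k.+1 + k.+1 = 1 + (2 * k + 1))%N by lia.
by rewrite iterD hk /= (qstep_principal nsq hq a1).
Qed.

Lemma even_period_middle D q k : nonsquare D -> qreduced D q -> qa q = 1 ->
  iter (2 * k) qstep q = q ->
  qflip (iter k qstep q) = qstep (iter k qstep q).
Proof.
move=> nsq hq a1 hk; apply: (iter_qstep_inj (i := k) nsq).
- exact/qreduced_flip/qreduced_iter.
- exact/qreduced_step/qreduced_iter.
rewrite (iter_qstep_flip _ nsq hq) -iterS -iterD.
have -> : (k + k.+1 = 1 + 2 * k)%N by lia.
by rewrite iterD hk /= (qstep_principal nsq hq a1).
Qed.

(** * Discriminant [9 p] *)

Lemma nonsquare_nine_prime p : prime p -> p <> 3%N -> nonsquare (9 * p)%N.
Proof.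
move=> pp p3 z /(congr1 absz); rewrite abszM absz_nat => E.
have p0 := prime_gt0 pp.
have : (p %| absz z * absz z)%N by rewrite E dvdn_mull.
rewrite Euclid_dvdM // orbb => /dvdnP[m hm]; move: E; rewrite hm => E.
have {}E : (m * m * p = 9)%N by apply/eqP; rewrite -(eqn_pmul2r p0); lia.
have : (p %| 3 * 3)%N by rewrite -[X in (_ %| X)%N]E dvdn_mull.
by rewrite Euclid_dvdM // orbb dvdn_prime2 // => /eqP.
Qed.

Lemma mod3_cases (x : int) :
  exists s, x = 3 * s \/ x = 3 * s + 1 \/ x = 3 * s + 2.
Proof.
exists (x %/ 3)%Z; have := divz_eq x 3.
have := ltz_pmod x (isT : 0 < 3 :> int); have := modz_ge0 x (isT : 3 != 0 :> int).
by lia.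
Qed.

(* The middle of an odd period would give [b^2 + 4 a^2 = 9 p], so that 3 would
   divide all values of the form. *)
Lemma qflip_fixed_nine p q e : qreduced (9 * p)%N q -> qflip q = q ->
  represents q e -> e = 1 \/ e = -1 -> False.
Proof.
case: q => a b c [_ _ _ _ /=]; rewrite /qdisc /= => hD [Ec _] [u [v]].
rewrite /qval /= => E he; rewrite Ec in hD E.
have [a' [b' [ha hb]]] : exists a' b', a = 3 * a' /\ b = 3 * b'.
  have [s hs] := mod3_cases a; have [t ht] := mod3_cases b; exists s, t.
  by case: hs ht => [|[]] ? [|[]] ?; subst; lia.
rewrite ha hb in E; have : 3 * (a' * u * u - b' * u * v - a' * v * v) = e.
  by rewrite -E; ring.
by case: he => ->; lia.
Qed.

Lemma nine_prime_middle p q n (e : int) : prime p -> p = 1 %[mod 4] ->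
  qreduced (9 * p)%N q -> qa q <> 1 -> qb q = qa q * n ->
  represents q e -> e = 1 \/ e = -1 ->
  (p = 5%N \/ p = 1 %[mod 3] -> e = -1) /\
  (p = 2 %[mod 3] /\ p <> 5%N -> e = 1).
Proof.
move=> pp p4; case: q => a b c [/= a0 c0 h1 h2]; rewrite /qdisc /= => hD a1 hb.
case=> u [v]; rewrite /qval /= => E he; subst b.
have n0 : 0 < n by rewrite -(pmulr_rgt0 _ a0); lia.
have bD : a * n * (a * n) < 9 * p%:Z by have := mulr_gt0 a0 c0; lia.
have : (absz a %| 9 * p)%N.
  apply/dvdnP; exists (absz (a * n * n + 4 * c)).
  by apply/eqP; rewrite -eqz_nat !PoszM !gez0_abs; [apply/eqP; lia | lia | nia].
have [/dvdnP[d hd] _|pa] := boolP (p %| absz a)%N.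
  have Ea : a = d%:Z * p%:Z by lia.
  have d0 : 0 < d%:Z by have := prime_gt1 pp; nia.
  (* Since [p] divides [a], [p <= a n], while [(a n)^2 < 9 p]. *)
  have p9 : (p < 9)%N.
    have : p%:Z <= a * n by rewrite Ea; nia.
    nia.
  have p5 : p = 5%N by have := prime_gt1 pp; lia.
  subst p; have : a * n = 5 by nia.
  move=> an; have a5 : a = 5 by nia.
  have n1 : n = 1 by lia.
  subst a n; have c1 : c = 1 by lia.
  subst c; split; last by case.
  move=> _; case: he => // he; rewrite he in E.
  have [s hs] := mod3_cases (2 * u - v).
  (* Modulo 3 this would make 2 a square. *)
  have : 5 * (2 * u - v) * (2 * u - v) - 9 * v * v = 4 by lia.
  by case: hs => [|[]] -> ?; lia.
rewrite Gauss_dvdl; last by rewrite coprime_sym prime_coprime.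
have [s hs] := mod3_cases v.
rewrite dvdn_divisors // => a9; have : a = 3 \/ a = 9.
  by move: a9; rewrite (_ : divisors 9 = [:: 1; 3; 9]%N) // !inE; lia.
case=> ?; subst a.
  (* For [a = 3] the discriminant makes 3 divide [c], hence every value of the form. *)
  have [t ht] : exists t, c = 3 * t by exists (p%:Z - n * n - c); lia.
  have : 3 * (u * u - n * u * v - t * v * v) = e by rewrite -E ht; ring.
  by case: he => ->; lia.
have E4 : 9 * ((2 * u - n * v) * (2 * u - n * v)) - p%:Z * (v * v) = 4 * e.
  have -> : p%:Z = 9 * n * n + 4 * c by lia.
  by rewrite -E; ring.
(* Only the factor 9 of [w] matters: modulo 3, [E4] reads [- p v^2 = e]. *)
move: (_ * (2 * u - n * v)) E4 => w E4.
have [r hr] := mod3_cases p%:Z.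
split.
- case=> [p5|p3]; first by subst p; have := mulr_gt0 n0 n0; lia.
  case: he => // he; rewrite he in E4; have {}hr : p%:Z = 3 * r + 1 by lia.
  by move: E4; rewrite hr; case: hs => [|[]] ->; lia.
- case=> p3 _; case: he => // he; rewrite he in E4.
  have {}hr : p%:Z = 3 * r + 2 by lia.
  by move: E4; rewrite hr; case: hs => [|[]] ->; lia.
Qed.

Theorem corollary3p9 (R : realType) (p : nat) (p_prime : prime p)
    (p_mod4 : p = 1 %[mod 4]) :
  let alpha : R := (1 + 3 * Num.sqrt p%:R) / 2 in
  (p = 5%N \/ p = 1 %[mod 3] ->
     exists2 l : nat, is_cf_period_length alpha l & l = 2 %[mod 4]) /\
  (p = 2 %[mod 3] /\ p <> 5%N ->
     exists2 l : nat, is_cf_period_length alpha l & l = 0 %[mod 4]).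
Proof.
move=> alpha.
have p0 := prime_gt0 p_prime.
have nsq : nonsquare (9 * p)%N by apply: nonsquare_nine_prime => //; lia.
have [m [q [hq a1 b1]]] : exists (m : nat) (q : qform),
    [/\ qreduced (9 * p)%N q, qa q = 1 & qb q = 2 * m%:Z + 1].
  pose k := ((9 * p) %/ 4)%N; have Ek : (9 * p = 4 * k + 1)%N by rewrite /k; lia.
  rewrite Ek in nsq *; have k_gt0 : (0 < k)%N by lia.
  have [m hm] := principal_qform nsq k_gt0.
  by exists m; eexists; split; [exact: hm | |].
have Ealpha : alpha = qroot R (9 * p)%N q + (- m%:Z)%:~R.
  have sqrt_nine : Num.sqrt (9 * p)%N%:~R = 3 * Num.sqrt p%:R :> R.
    rewrite -pmulrn natrM sqrtrM // (_ : 9%:R = 3 ^+ 2); last by rewrite -natrX.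
    by rewrite sqrtr_sqr ger0_norm.
  rewrite /qroot sqrt_nine a1 b1 mulr1 rmorphN rmorphD rmorphM /= /alpha.
  by field.
have exl : exists l : nat, (0 < l)%N && `[< iter l qstep q = q >].
  by have [l [l0 hl]] := qstep_periodic nsq hq; exists l; rewrite l0; apply/asboolP.
case: (ex_minnP exl) => l /andP[l0 /asboolP hl] lmin'.
have lmin j : (0 < j)%N -> iter j qstep q = q -> (l <= j)%N.
  by move=> j0 hj; apply: lmin'; rewrite j0; apply/asboolP.
have hper : is_cf_period_length alpha l.
  by rewrite Ealpha; apply: cf_period_length_qroot.
have rep i := represents_iter i (represents_principal a1).
have sgn i : (-1) ^+ i = 1 :> int \/ (-1) ^+ i = -1 :> int.
  by rewrite -signr_odd; case: odd; [right|left].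
have [k Ek] : exists k, (l = 2 * k)%N.
  exists l./2; have := odd_double_half l; case: (odd l); last by lia.
  move=> El; exfalso; have hk : iter (2 * l./2 + 1) qstep q = q.
    by rewrite (_ : (_ + 1)%N = l) //; lia.
  exact: (qflip_fixed_nine (qreduced_iter _ nsq hq)
    (odd_period_middle nsq hq a1 hk) (rep _) (sgn _)).
have hk : iter (2 * k) qstep q = q by rewrite -Ek.
have mid := even_period_middle nsq hq a1 hk.
have [n hn] : exists n, qb (iter k qstep q) = qa (iter k qstep q) * n.
  (* The middle coefficients in [mid] give [b = 2 a n - b]. *)
  exists (quot (iter k qstep q)); have := congr1 qb mid; rewrite /= ; lia.
have ak : qa (iter k qstep q) <> 1.
  (* The cycle would already close after [k] steps, against the minimality of [l = 2 k]. *)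
  move=> ak; have := principal_qform_unique (qreduced_iter k nsq hq) hq ak a1.
  by move=> /lmin; lia.
have [H1 H2] := nine_prime_middle p_prime p_mod4 (qreduced_iter k nsq hq) ak hn
  (rep k) (sgn k).
split=> [/H1|/H2] hs; exists l => //; move: hs; rewrite -signr_odd.
- by have := odd_double_half k; case: (odd k) => // ?; lia.
- by have := odd_double_half k; case: (odd k) => // ?; lia.
Qed.
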